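(* Let $f,h:X\to\mathbb{R}\cup\{\infty\}$ satisfy the standing assumptions in the context. Let $\alpha_k\in[0,1]$, $k=0,1,2,\dots$, and let $(x_k,u_k,s_k)$, $k=0,1,2,\dots$, be the iterates generated by the generalized conditional subgradient algorithm (defined in the context) with step sizes $\alpha_k$, started from $x_0\in\operatorname{dom}(\partial f)$. If $\alpha_0=1$, then for all $k=1,2,\dots$ $$\sum_{i=0}^{k-1}\lambda_i^k\bigl(f^*(u_i)+h^*(-u_i)\bigr)-\sum_{i=0}^{k-1}\mu_i^k\,\mathcal{D}_{f,h}(x_i,s_i,\alpha_i)=-f(x_k)-h(x_k).$$
   Context: Setting. $X$ is a finite-dimensional real vector space with dual $X^*$ and pairing $\langle\cdot,\cdot\rangle$. $f,h:X\to\mathbb{R}\cup\{\infty\}$ are proper closed convex functions with Fenchel conjugates $f^*,h^*:X^*\to\mathbb{R}\cup\{\infty\}$. $\operatorname{dom}(\partial f)\subseteq X$ and $\operatorname{dom}(\partial h^* )\subseteq X^*$ are the sets of points at which the respective subdifferential is nonempty. Single-valued oracles are fixed: for each $y\in\operatorname{dom}(\partial f)$, $\partial f(y)\in X^*$ denotes one fixed chosen element of $\operatorname{argmax}_{v\in X^*}\{\langle v,y\rangle-f^*(v)\}$ (the subdifferential of $f$ at $y$); for each $u\in\operatorname{dom}(\partial h^* )$, $\partial h^*(u)\in X$ denotes one fixed chosen element of $\operatorname{argmax}_{x\in X}\{\langle u,x\rangle-h(x)\}$ (the subdifferential of $h^*$ at $u$). Standing assumption: $-\partial f(y)\in\operatorname{dom}(\partial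 h^* )$ for all $y\in\operatorname{dom}(\partial f)$, and $\partial h^*(u)\in\operatorname{dom}(\partial f)$ for all $u\in\operatorname{dom}(\partial h^* )$. Generalized Bregman distance: $D_f(y,x)=f(y)-f(x)-\langle\partial f(x),y-x\rangle$ for $x\in\operatorname{dom}(\partial f)$, $y\in\operatorname{dom}(f)$, with the chosen subgradient $\partial f(x)$. Notation: $\mathcal{D}_{f,h}(x,s,\alpha):=D_f((1-\alpha)x+\alpha s,x)+h((1-\alpha)x+\alpha s)-(1-\alpha)h(x)-\alpha h(s)$, with the convention $0\cdot\infty=0$ (relevant only for $i=0$, $\alpha_0=1$). Generalized conditional subgradient algorithm: given $x_0\in\operatorname{dom}(\partial f)$, for $k=0,1,2,\dots$: $u_k:=\partial f(x_k)$, $s_k:=\partial h^*(-u_k)$, $x_{k+1}:=(1-\alpha_k)x_k+\alpha_ks_k$, where $\alpha_k\in[0,1]$. The iterates are understood to be well defined, i.e. $x_k\in\operatorname{dom}(\partial f)$ for all $k$. Weights: for $k=0,1,2,\dots$, $\lambda^{k+1}_k=\alpha_k$, $\mu^{k+1}_k=1$, and $\lambda^{k+1}_i=(1-\alpha_k)\lambda^k_i$, $\mu^{k+1}_i=(1-\alpha_k)\mu^k_i$ for $i=0,\dots,k-1$. *)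

(* Defs.v *)
From HB Require Import structures.
From mathcomp Require Export all_boot all_order all_algebra.
From mathcomp Require Export all_classical all_reals all_analysis.
Export numFieldNormedType.Exports.

Set Implicit Arguments.
Unset Strict Implicit.
Unset Printing Implicit Defensive.

Import Order.TTheory GRing.Theory Num.Theory.

Local Open Scope classical_set_scope.
Local Open Scope ring_scope.
Local Open Scope ereal_scope.

Section ConvexAnalysis.
Context {R : realType} {X : vectType R}.
Implicit Types (f h : X -> \bar R).

(* The first component says that f takes its values in R \cup {+oo}. *)
Definition proper f : Prop :=
  (forall x, f x != -oo) /\ (exists x, f x < +oo).

Definition epigraph f : set (X * R^o) := [set p | f p.1 <= (p.2)%:E].

Definition convex_fun f : Prop :=
  @convex_set R (X * R^o)%type (epigraph f).

(* X carries no topology in the library: the epigraph is read in coordinates,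
   through a linear isomorphism 'rV_n -> X.  The resulting notion is independent
   of the isomorphism, as X has only one Hausdorff vector space topology. *)
Definition closed_fun f : Prop :=
  closed [set p : 'rV[R]_(\dim {:X}) * R |
            epigraph f (passmx.vecof (vbasis {:X}) p.1, p.2)].

Definition conjugate f (v : 'Hom(X, R^o)) : \bar R :=
  ereal_sup [set (v x)%:E - f x | x in [set: X]].

Definition argmax {T : Type} (g : T -> \bar R) : set T :=
  [set t | forall t', g t' <= g t].

Definition subdiff f (y : X) : set 'Hom(X, R^o) :=
  argmax (fun v : 'Hom(X, R^o) => (v y)%:E - conjugate f v).

(* Subdifferential of the conjugate of h, as a subset of X rather than of the
   bidual. *)
Definition subdiff_conj h (u : 'Hom(X, R^o)) : set X :=
  argmax (fun x : X => (u x)%:E - h x).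

Definition dom_subdiff f : set X := [set y | subdiff f y !=set0].

Definition dom_subdiff_conj h : set 'Hom(X, R^o) :=
  [set u | subdiff_conj h u !=set0].

(* Oracles are total functions; their values are constrained only on the
   domain of the subdifferential. *)
Definition subgrad_oracle f (df : X -> 'Hom(X, R^o)) : Prop :=
  forall y, dom_subdiff f y -> subdiff f y (df y).

Definition subgrad_conj_oracle h (dh : 'Hom(X, R^o) -> X) : Prop :=
  forall u, dom_subdiff_conj h u -> subdiff_conj h u (dh u).

Definition bregman f (df : X -> 'Hom(X, R^o)) (y x : X) : \bar R :=
  f y - f x - (df x (y - x)%R)%:E.

(* In \bar R, 0 * +oo = 0. *)
Definition Dfh f h (df : X -> 'Hom(X, R^o)) (x s : X) (a : R) : \bar R :=
  let z := ((1 - a) *: x + a *: s)%R in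
  bregman f df z x + h z - (1 - a)%:E * h x - a%:E * h s.

Definition gcs_iterates f (df : X -> 'Hom(X, R^o)) (dh : 'Hom(X, R^o) -> X)
    (alpha : nat -> R) (x : nat -> X) (u : nat -> 'Hom(X, R^o))
    (s : nat -> X) : Prop :=
  forall k : nat,
    [/\ dom_subdiff f (x k),
        u k = df (x k),
        s k = dh (- u k)%R &
        x k.+1 = ((1 - alpha k) *: x k + alpha k *: s k)%R].

End ConvexAnalysis.

(* lambda_weight alpha k i and mu_weight alpha k i are the weights with upper
   index k and lower index i, meaningful for i < k. *)
Fixpoint lambda_weight {R : realType} (alpha : nat -> R) (k i : nat) : R :=
  if k is k'.+1 then
    if i == k' then alpha k' else ((1 - alpha k') * lambda_weight alpha k' i)%R
  else 0%R.

Fixpoint mu_weight {R : realType} (alpha : nat -> R) (k i : nat) : R :=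
  if k is k'.+1 then
    if i == k' then 1%R else ((1 - alpha k') * mu_weight alpha k' i)%R
  else 0%R.

(* Main.v *)
(* At a chosen subgradient u_i = df (x_i) the Fenchel-Young inequality is an
   equality, f(x_i) + f*(u_i) = <u_i, x_i>, and likewise
   h(s_i) + h*(-u_i) = -<u_i, s_i>.  Substituting both, the two sums satisfy the
   same recursion S_{i+1} = (1 - alpha_i) S_i + alpha_i a_i - d_i as
   g_i = -f(x_i) - h(x_i), and alpha_0 = 1 erases the initial values, where
   h(x_0) may be infinite.
   As df (x_i) is a maximizer of v |-> <v, x_i> - f*(v), the first equality needs
   f** = f (Fenchel-Moreau), proved by separating a point below the graph from
   the epigraph through its nearest point. *)
Require Import Defs.
From mathcomp Require Import ring lra.
Set Implicit Arguments.
Unset Strict Implicit.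
Unset Printing Implicit Defensive.

Import Order.TTheory GRing.Theory Num.Theory passmx.

Local Open Scope classical_set_scope.
Local Open Scope ring_scope.

(** * Euclidean geometry of coordinate-height pairs and nearest points *)

Definition dot (R : realType) n (p q : 'rV[R]_n * R) : R :=
  \sum_i p.1 0 i * q.1 0 i + p.2 * q.2.

Section Dot.
Context {R : realType} {n : nat}.
Implicit Types p q : 'rV[R]_n * R.

Lemma dotC p q : dot p q = dot q p.
Proof.
rewrite /dot mulrC; congr (_ + _); apply: eq_bigr => i _; exact: mulrC.
Qed.

Lemma dotDl p q r : dot (p + q) r = dot p r + dot q r.
Proof.
rewrite /dot /= mulrDl addrACA -big_split /=; congr (_ + _).
by apply: eq_bigr => i _; rewrite mxE mulrDl.
Qed.

Lemma dotZl (a : R) p r : dot (a *: p.1, a * p.2) r = a * dot p r.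
Proof.
rewrite /dot /= mulrDr mulr_sumr mulrA; congr (_ + _).
by apply: eq_bigr => i _; rewrite mxE mulrA.
Qed.

Lemma dotDD p q : dot (p + q) (p + q) = dot p p + 2 * dot p q + dot q q.
Proof. by rewrite dotDl ![dot _ (p + q)]dotC !dotDl [dot q p]dotC; ring. Qed.

Lemma dot_ge0 p : 0 <= dot p p.
Proof. by rewrite addr_ge0 ?sumr_ge0// => [i _|]; rewrite -expr2 sqr_ge0. Qed.

Lemma dot_eq0 p : dot p p <= 0 -> p = 0.
Proof.
move=> p0; have s_ge0 i : true -> 0 <= p.1 0 i * p.1 0 i.
  by rewrite -expr2 sqr_ge0.
have s0 : 0 <= \sum_i p.1 0 i * p.1 0 i by exact: sumr_ge0.
have q0 : 0 <= p.2 * p.2 by rewrite -expr2 sqr_ge0.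
rewrite /dot in p0.
set S := \sum_i _ in s0 p0.
have /eqP : S = 0 by lra.
rewrite /S psumr_eq0// => /allP p1.
have /eqP : p.2 * p.2 = 0 by lra.
rewrite mulf_eq0 orbb => /eqP p2.
case: p p1 p2 {S p0 s_ge0 s0 q0} => v t /= p1 ->; congr pair.
apply/rowP => i; rewrite mxE; apply/eqP.
by have := p1 i (mem_index_enum i); rewrite mulf_eq0 orbb.
Qed.

(** A crude bound free of square roots, [a * a <= r] giving [|a| <= 1 + r]; it encloses a ball in a
    compact box. *)
Lemma dot_coord_le p (r : R) : dot p p <= r ->
  (forall i, `|p.1 0 i| <= 1 + r) /\ `|p.2| <= 1 + r.
Proof.
move=> pr; have sq1 (a : R) : a * a <= r -> `|a| <= 1 + r.
  by rewrite ler_norml => ar; apply/andP; split; nra.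
have p2 : 0 <= p.2 * p.2 by rewrite -expr2 sqr_ge0.
have sum_ge0 (P : pred 'I_n) : 0 <= \sum_(i | P i) p.1 0 i * p.1 0 i.
  by apply: sumr_ge0 => i _; rewrite -expr2 sqr_ge0.
split=> [i|]; apply: sq1; apply: le_trans pr; rewrite /dot.
  by rewrite (bigD1 i)//= -addrA lerDl addr_ge0.
by rewrite lerDr.
Qed.

Lemma dot_continuous p : continuous (fun q => dot (q - p) (q - p)).
Proof.
move=> q; rewrite /dot /=.
have c1 i : (fun q : 'rV[R]_n * R => q.1 0 i) x @[x --> q] --> q.1 0 i.
  apply: (@continuous_comp _ _ _ fst (fun v : 'rV[R]_n => v 0 i)).
    exact: cvg_fst.
  exact: coord_continuous.
apply: cvgD.
  apply: cvg_big => [|i _]; first exact: add_continuous.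
  under eq_fun do rewrite !mxE.
  rewrite !mxE.
  by apply: cvgM; apply: cvgB; [exact: c1|exact: cvg_cst|exact: c1|exact: cvg_cst].
by apply: cvgM; apply: cvgB; [exact: cvg_snd|exact: cvg_cst|exact: cvg_snd|exact: cvg_cst].
Qed.

(** Points of [C] no farther from [p] than [c0] lie in the compact box [B], so the squared distance
    attains its minimum on the intersection; all other points are beaten by [c0]. *)
Lemma nearest_point (C : set ('rV[R]_n * R)) p : closed C -> C !=set0 ->
  exists2 q, C q & forall c, C c -> dot (q - p) (q - p) <= dot (c - p) (c - p).
Proof.
move=> clC [c0 Cc0]; set r := dot (c0 - p) (c0 - p).
pose B := [set v : 'rV[R]_n | forall i,
    `[p.1 0 i - (1 + r), p.1 0 i + (1 + r)]%classic (v ord0 i)] `*`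
  `[p.2 - (1 + r), p.2 + (1 + r)]%classic.
have inB c : dot (c - p) (c - p) <= r -> B c.
  move=> /dot_coord_le[c1 c2]; split => [i|] /=.
    by have := c1 i; rewrite !mxE in_itv/= -ler_distl.
  by rewrite in_itv/= -ler_distl.
have cptB : compact B.
  apply: compact_setX; last exact: segment_compact.
  apply: (@rV_compact R n (fun i => `[p.1 0 i - (1 + r), p.1 0 i + (1 + r)]%classic)) => i.
  exact: segment_compact.
have [|||q] := @compact_EVT_min ('rV[R]_n * R)%type R (fun c => dot (c - p) (c - p)) (B `&` C).
- by exists c0; split => //; exact: inB.
- exact: compact_closedI.
- by apply: continuous_subspaceT => c; exact: dot_continuous.
rewrite inE => -[_ Cq] qmin; exists q => // c Cc.
have [cr|/ltW rc] := leP (dot (c - p) (c - p)) r.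
  by apply: qmin; rewrite inE; split => //; exact: inB.
apply: le_trans rc; apply: qmin; rewrite inE; split => //; exact: inB.
Qed.

(* Scaling is componentwise because R, unlike R^o, is not an lmodType. *)
Lemma nearest_point_obtuse (C : set ('rV[R]_n * R)) p q :
  (forall c d (l : R), C c -> C d -> 0 <= l <= 1 ->
    C (c + (l *: (d - c).1, l * (d - c).2))) ->
  C q -> (forall c, C c -> dot (q - p) (q - p) <= dot (c - p) (c - p)) ->
  forall c, C c -> dot (p - q) (c - q) <= 0.
Proof.
move=> cvxC Cq qmin c Cc; rewrite leNgt; apply/negP => a_gt0.
have e_ge0 := dot_ge0 (c - q).
set a := dot _ _ in a_gt0; set e := dot _ _ in e_ge0.
(* Moving from [q] towards [c] by [l] changes the squared distance by [l ^ 2 * e - 2 * l * a], which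
   is negative since [l * e <= a]. The denominator [a + e] also keeps [l] at most 1. *)
pose l := a / (a + e).
have ae : 0 < a + e by lra.
have lae : l * (a + e) = a by rewrite divfK// gt_eqF.
have l01 : 0 <= l <= 1 by rewrite divr_ge0 ?ler_pdivrMr//; lra.
have := qmin _ (cvxC q c l Cq Cc l01).
set m := (l *: _, _).
have -> : q + m - p = (q - p) + m by rewrite addrAC.
have mE r : dot m r = l * dot (c - q) r by exact: dotZl.
have aE : dot (q - p) (c - q) = - a.
  apply/eqP; rewrite -addr_eq0 -dotDl [_ + (p - q)]addrC subrKA subrr.
  rewrite /dot /= mul0r addr0 big1// => i _; by rewrite mxE mul0r.
rewrite (dotDD (q - p) m) [dot (q - p) m]dotC !mE [dot _ m]dotC mE -/e [dot (c - q) (q - p)]dotC aE.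
nra.
Qed.

End Dot.

(** * Separation from the epigraph and the Fenchel-Moreau theorem *)

Section FenchelMoreau.
Context {R : realType} {X : vectType R} (f : X -> \bar R).
Context (f_convex : convex_fun f).

Lemma convex_epigraph x y (a b l : R) : (f x <= a%:E)%E -> (f y <= b%:E)%E ->
  0 <= l <= 1 ->
  (f ((1 - l) *: x + l *: y) <= ((1 - l) * a + l * b)%:E)%E.
Proof.
move=> fx fy /andP[l0 l1].
have xa : (x, a) \in (epigraph f : set (convex_lmodType (X * R^o)%type)).
  by rewrite inE.
have yb : (y, b) \in (epigraph f : set (convex_lmodType (X * R^o)%type)).
  by rewrite inE.
have := f_convex (Itv01 l0 l1) yb xa.
by rewrite inE /epigraph /conv /= addrC [X in (X%:E)]addrC.
Qed.

Context (f_closed : closed_fun f).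

(** The hyperplane through the nearest point [q], normal to [d = p - q], separates: the obtuse angle
    keeps the epigraph on one side and [dot d d > 0] puts [p] strictly on the other. It is vertical
    when [b = 0]. *)
Lemma epigraph_separation y (t : R) : (exists x, f x < +oo)%E ->
  (t%:E < f y)%E ->
  exists (w : 'Hom(X, R^o)) (b c : R),
    [/\ 0 <= b, forall x r, (f x <= r%:E)%E -> w x - b * r <= c &
        c < w y - b * t].
Proof.
move=> [x0 fx0] ty.
pose e := vbasis {:X}; have be : basis_of {:X} e by exact: vbasisP.
pose C := [set p : 'rV[R]_(\dim {:X}) * R | epigraph f (vecof e p.1, p.2)].
have CE x r : (f x <= r%:E)%E -> C (rVof e x, r).
  by rewrite /C /epigraph /= rVofK.
have C0 : C !=set0.
  case fx0E : (f x0) fx0 => [r| |] // _.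
    by exists (rVof e x0, r); apply: CE; rewrite fx0E.
  by exists (rVof e x0, 0); apply: CE; rewrite fx0E leNye.
pose p := (rVof e y, t).
have [q Cq qmin] := nearest_point p f_closed C0.
have cvxC c d (l : R) : C c -> C d -> 0 <= l <= 1 ->
    C (c + (l *: (d - c).1, l * (d - c).2)).
  move=> Cc Cd l01; have := convex_epigraph Cc Cd l01.
  rewrite /C /epigraph /= [vecof e (_ + _)]linearD/=
    [vecof e (_ *: _)]linearZ/= [vecof e (_ - _)]linearB/=.
  congr (f _ <= _%:E)%E; last by ring.
  by rewrite scalerBl scale1r scalerBr addrA addrAC.
have obt := nearest_point_obtuse cvxC Cq qmin.
set d := p - q in obt.
have dq c : C c -> dot d c <= dot d q.
  move=> /obt; rewrite [dot d (c - q)]dotC.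
  by have := dotDl q (c - q) d; rewrite subrKC ![dot _ d]dotC; lra.
have dd : 0 < dot d d.
  rewrite ltNge; apply/negP => /dot_eq0/subr0_eq pq.
  have : C p by rewrite pq.
  by rewrite /C /epigraph/= rVofK// leNgt ty.
pose w : 'Hom(X, R^o) := \sum_i d.1 0 i *: linfun (coord e i : X -> R^o).
have wE x r : w x + d.2 * r = dot d (rVof e x, r).
  rewrite /w sum_lfunE /dot/=; congr (_ + _); apply: eq_bigr => i _.
  by rewrite scale_lfunE lfunE/= coord_rVof.
exists w, (- d.2), (dot d q); split.
(* The epigraph is closed upwards, so the obtuse-angle inequality at the point one unit above [q]
   reads [d.2 <= 0]. *)
- have /obt : C (q + (0, 1)).
    rewrite /C /epigraph /= addr0; apply: le_trans Cq _.
    by rewrite lee_fin lerDl.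
  rewrite /dot /= big1 => [|i _]; last by rewrite !mxE addrAC subrr add0r mulr0.
  by rewrite addrAC subrr !add0r mulr1 oppr_ge0.
- by move=> x r /CE/dq; rewrite -wE mulNr opprK.
- rewrite mulNr opprK wE -/p.
  have := dotDl d q d; rewrite subrK [dot p d]dotC [dot q d]dotC; lra.
Qed.

Context (f_proper : proper f).

Lemma conjugate_le (v : 'Hom(X, R^o)) (b : R) :
  (forall x, ((v x - b)%:E <= f x)%E) -> (conjugate f v <= b%:E)%E.
Proof.
move=> vb; apply: ge_ereal_sup => _ [x _ <-].
have := vb x; case: (f x) (f_proper.1 x) => [r| |] //= _; last by rewrite leNye.
by rewrite -EFinB !lee_fin; lra.
Qed.

(* Below a point of the domain of f the separating hyperplane is not vertical. *)
Lemma affine_minorant :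
  exists (v : 'Hom(X, R^o)) (b : R), forall x, ((v x - b)%:E <= f x)%E.
Proof.
have [fNy [x0 fx0]] := f_proper.
case fx0E : (f x0) (fNy x0) fx0 => [r| |] // _ _.
have [||w [b [c [b0 wf wc]]]] := @epigraph_separation x0 (r - 1).
- by exists x0; rewrite fx0E ltry.
- by rewrite fx0E lte_fin; lra.
(* The bound at the graph point [(x0, r)] together with [c < w x0 - b * (r - 1)] forces [b > 0]. *)
have b_gt0 : 0 < b.
  have := wf x0 r; rewrite fx0E lexx => /(_ isT); nra.
exists (b^-1 *: w), (b^-1 * c) => x.
case fxE : (f x) (fNy x) => [s| |] // _; rewrite ?leey//.
have := wf x s; rewrite fxE lexx => /(_ isT) ws.
rewrite lee_fin scale_lfunE -mulrBr mulrC ler_pdivrMr//; lra.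
Qed.

(** This is [f <= f**] tested on real heights [t]; a real bound [b] on the conjugate avoids infinite
    values. *)
Lemma fenchel_moreau y (t : R) : (t%:E < f y)%E ->
  exists (v : 'Hom(X, R^o)) (b : R),
    (conjugate f v <= b%:E)%E /\ t < v y - b.
Proof.
move=> ty; have [fNy f_dom] := f_proper.
have [w [b [c [b0 wf wc]]]] := epigraph_separation f_dom ty.
move: b0; rewrite le_eqVlt => /predU1P[b0|b_gt0].
  (* Vertical hyperplane: tilt an affine minorant by a large multiple of w. *)
  have [v [a va]] := affine_minorant.
  have wy : 0 < w y - c by move: wc; rewrite -b0; lra.
  (* The multiple makes the gain [m * (w y - c)] at [y] exceed the gap [t - (v y - a)]. On the
     domain of [f] the added term [m * (w x - c)] is nonpositive, so a minorant remains. *)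
  pose m := (`|t - (v y - a)| + 1) / (w y - c).
  have m0 : 0 <= m by apply: divr_ge0; [exact: addr_ge0|exact: ltW].
  have mE : m * (w y - c) = `|t - (v y - a)| + 1 by rewrite divfK// gt_eqF.
  exists (v + m *: w), (a + m * c); split.
    apply: conjugate_le => x; have := va x.
    case fxE : (f x) (fNy x) => [s| |] // _; rewrite ?leey// !lee_fin => vs.
    have := wf x s; rewrite fxE lexx -b0 => /(_ isT) ws.
    rewrite add_lfunE scale_lfunE -[_ *: w x]/(m * w x); have : m * (c - w x) >= 0.
      by rewrite mulr_ge0//; lra.
    lra.
  have := ler_norm (t - (v y - a)).
  by rewrite add_lfunE scale_lfunE -[_ *: w y]/(m * w y); lra.
(* A non-vertical hyperplane, divided by [b], is the graph of an affine minorant. *)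
exists (b^-1 *: w), (b^-1 * c); split.
  apply: conjugate_le => x.
  case fxE : (f x) (fNy x) => [s| |] // _; rewrite ?leey//.
  have := wf x s; rewrite fxE lexx => /(_ isT) ws.
  rewrite lee_fin scale_lfunE -mulrBr mulrC ler_pdivrMr//; lra.
rewrite scale_lfunE -mulrBr mulrC ltr_pdivlMr//; lra.
Qed.

(** * Fenchel-Young equalities at maximizers *)

Lemma fenchel_young y (v : 'Hom(X, R^o)) :
  ((v y)%:E - f y <= conjugate f v)%E.
Proof. by apply: ereal_sup_ubound; exists y. Qed.

(** If [f y] exceeded [v y - f*(v)], Fenchel-Moreau would supply a better slope than the maximizer
    [v]. The value [f*(v)] is finite: a point of the domain bounds it below, and the slope of an
    affine minorant excludes [+oo]. *)
Lemma subdiff_fenchel_young y v : subdiff f y v ->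
  exists a b : R, [/\ f y = a%:E, conjugate f v = b%:E & a + b = v y].
Proof.
move=> vmax; have [fNy [x0 fx0]] := f_proper.
have [v0 [b0 v0b0]] := affine_minorant.
have := vmax v0; have := conjugate_le v0b0.
have := fenchel_young x0 v.
case fx0E : (f x0) (fNy x0) fx0 => [r| |] // _ _.
case vE : (conjugate f v) => [b| |] //.
  move=> _ _ _.
  have fyb : (f y <= (v y - b)%:E)%E.
    rewrite leNgt; apply/negP => /fenchel_moreau[v1 [b1 [v1b1]]].
    have := vmax v1; rewrite vE.
    move: v1b1; have := fenchel_young x0 v1; rewrite fx0E.
    case: (conjugate f v1) => [b'| |] //=; rewrite !lee_fin; lra.
  have := fenchel_young y v; rewrite vE.
  case fyE : (f y) (fNy y) fyb => [a| |] //= _; rewrite !lee_fin => ab ba.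
  by exists a, b; split => //; lra.
by move=> _; case: (conjugate f v0).
Qed.

(** The maximizer [x] attains the supremum that defines [f*(v)]. *)
Lemma subdiff_conj_fenchel_young (v : 'Hom(X, R^o)) x : subdiff_conj f v x ->
  exists a b : R, [/\ f x = a%:E, conjugate f v = b%:E & a + b = v x].
Proof.
move=> xmax; have [fNy [x0 fx0]] := f_proper.
have fvE : (conjugate f v = (v x)%:E - f x)%E.
  apply/eqP; rewrite eq_le fenchel_young andbT.
  by apply: ge_ereal_sup => _ [x' _ <-]; exact: xmax.
have := xmax x0; rewrite fvE.
case fxE : (f x) (fNy x) => [a| |] // _.
  by move=> _; exists a, (v x - a); split=> //; lra.
by case: (f x0) (fNy x0) fx0.
Qed.

End FenchelMoreau.

(** * Recursions for the weighted sums *)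

Lemma sum_lambda_weightS (R : realType) (alpha a : nat -> R) k :
  \sum_(i < k.+1) lambda_weight alpha k.+1 i * a i =
  (1 - alpha k) * \sum_(i < k) lambda_weight alpha k i * a i + alpha k * a k.
Proof.
rewrite big_ord_recr /= eqxx; congr (_ + _); rewrite mulr_sumr.
by apply: eq_bigr => i _; rewrite ltn_eqF// mulrA.
Qed.

Lemma sum_mu_weightS (R : realType) (alpha a : nat -> R) k :
  \sum_(i < k.+1) mu_weight alpha k.+1 i * a i =
  (1 - alpha k) * \sum_(i < k) mu_weight alpha k i * a i + a k.
Proof.
rewrite big_ord_recr /= eqxx mul1r; congr (_ + _); rewrite mulr_sumr.
by apply: eq_bigr => i _; rewrite ltn_eqF// mulrA.
Qed.

Lemma weighted_telescope (R : realType) (alpha a d g : nat -> R) k :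
  alpha 0%N = 1 ->
  (forall i, g i.+1 = (1 - alpha i) * g i + alpha i * a i - d i) ->
  (0 < k)%N ->
  \sum_(i < k) lambda_weight alpha k i * a i
    - \sum_(i < k) mu_weight alpha k i * d i = g k.
Proof.
move=> alpha0 gS; case: k => // k _; elim: k => [|k IHk].
  (* At index 1 the factor [1 - alpha 0 = 0] removes [g 0]. *)
  by rewrite !big_ord1 gS /= alpha0; ring.
by rewrite sum_lambda_weightS sum_mu_weightS gS -IHk; ring.
Qed.

(** * The identity for the iterates *)

Local Open Scope ereal_scope.

Theorem theorem1 (R : realType) (X : vectType R) (f h : X -> \bar R)
    (df : X -> 'Hom(X, R^o)) (dh : 'Hom(X, R^o) -> X)
    (f_proper : proper f) (f_closed : closed_fun f) (f_convex : convex_fun f)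
    (h_proper : proper h) (h_closed : closed_fun h) (h_convex : convex_fun h)
    (df_oracle : subgrad_oracle f df) (dh_oracle : subgrad_conj_oracle h dh)
    (df_dom : forall y, dom_subdiff f y -> dom_subdiff_conj h (- df y)%R)
    (dh_dom : forall u, dom_subdiff_conj h u -> dom_subdiff f (dh u))
    (alpha : nat -> R) (alpha01 : forall k, (0 <= alpha k <= 1)%R)
    (x : nat -> X) (u : nat -> 'Hom(X, R^o)) (s : nat -> X)
    (xus : gcs_iterates f df dh alpha x u s)
    (alpha0 : alpha 0%N = 1%R) (k : nat) (k_gt0 : (0 < k)%N) :
  \sum_(i < k) (lambda_weight alpha k i)%:E
      * (conjugate f (u i) + conjugate h (- u i)%R)
  - \sum_(i < k) (mu_weight alpha k i)%:E * Dfh f h df (x i) (s i) (alpha i)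
  = - f (x k) - h (x k).
Proof.
have fy i : exists a b : R,
    [/\ f (x i) = a%:E, conjugate f (u i) = b%:E & (a + b = u i (x i))%R].
  have [xi -> _ _] := xus i; exact: subdiff_fenchel_young (df_oracle _ xi).
have hy i : exists a b : R, [/\ h (s i) = a%:E,
    conjugate h (- u i)%R = b%:E & (a + b = - u i (s i))%R].
  have [xi ui -> _] := xus i.
  have [a [b [hs hc ab]]] := subdiff_conj_fenchel_young h_proper
    (dh_oracle _ (df_dom _ xi)).
  by exists a, b; rewrite ui hs hc ab opp_lfunE.
have fE i : f (x i) = (fine (f (x i)))%:E by have [a [b [-> _ _]]] := fy i.
have hsE i : h (s i) = (fine (h (s i)))%:E by have [a [b [-> _ _]]] := hy i.
have xS i : x i.+1 = ((1 - alpha i) *: x i + alpha i *: s i)%R by have [] := xus i.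
(* Finiteness of [h] starts at index 1, where [x 1 = s 0], and convexity propagates it. *)
have hE i : h (x i.+1) = (fine (h (x i.+1)))%:E.
  elim: i => [|i IHi].
    by rewrite xS alpha0 subrr scale0r add0r scale1r.
  have := convex_epigraph h_convex (a := fine (h (x i.+1)))
    (b := fine (h (s i.+1))) _ _ (alpha01 i.+1).
  rewrite -IHi -hsE => /(_ _ _ (lexx _) (lexx _)); rewrite -xS.
  by case: (h (x i.+2)) (h_proper.1 (x i.+2)).
(* Real counterparts of the summands. If [h (x 0)] is infinite, [fine] returns the default 0,
   harmless as it is multiplied by [1 - alpha 0 = 0]. *)
pose a i := (u i (x i) - u i (s i) - fine (f (x i)) - fine (h (s i)))%R.
pose d i := (fine (f (x i.+1)) - fine (f (x i)) - u i (x i.+1 - x i)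
  + fine (h (x i.+1)) - (1 - alpha i) * fine (h (x i))
  - alpha i * fine (h (s i)))%R.
have aE i : conjugate f (u i) + conjugate h (- u i)%R = (a i)%:E.
  have [b [c [fb -> bc]]] := fy i; have [b' [c' [hb -> bc']]] := hy i.
  by rewrite /a fb hb -EFinD /=; congr (_%:E); lra.
have dE i : Dfh f h df (x i) (s i) (alpha i) = (d i)%:E.
  have [_ ui _ _] := xus i.
  rewrite /Dfh /bregman -xS -ui (fE i.+1) (fE i) (hE i) (hsE i).
  suff -> : (1 - alpha i)%:E * h (x i) = ((1 - alpha i) * fine (h (x i)))%:E by [].
  by case: i {ui} => [|i]; [rewrite alpha0 subrr mul0e mul0r|rewrite hE].
under eq_bigr do rewrite aE -EFinM.
under [X in _ - X = _]eq_bigr do rewrite dE -EFinM.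
rewrite !sumEFin -EFinB.
pose g i := (- fine (f (x i)) - fine (h (x i)))%R.
rewrite (@weighted_telescope _ alpha a d g)//.
  by case: k k_gt0 => // k _; rewrite fE hE.
(* The step is [alpha i] times [s i - x i], so the linear term of the Bregman distance cancels the
   pairings in [alpha i * a i]. *)
move=> i; have dx : (x i.+1 - x i = alpha i *: (s i - x i))%R.
  by rewrite xS scalerBl scale1r scalerBr addrC !addrA addNr add0r addrC.
have uS : u i (x i.+1 - x i)%R = (alpha i * (u i (s i) - u i (x i)))%R.
  by rewrite dx linearZ/= linearB.
by rewrite /g /a /d uS; ring.
Qed.
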